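(* Let $u$ be a real algebraic number of degree $3$ over $\mathbb{Q}$. Then: (1) $u\in\mathcal{C}$, i.e. $u$ is the limit of a convergent generalized continued fraction of polynomial type. (2) More precisely, for every $M>0$ there exist a real constant $E$ with $|E|>M$ (in particular one may take $|E|>1$), a generalized continued fraction of polynomial type whose convergents $p(n)/q(n)$ converge to $u$, and a constant $C\neq 0$ such that $$u-\frac{p(n)}{q(n)}\sim \frac{C}{E^n n^{3/2}}\quad (n\to\infty).$$
   Context: A generalized continued fraction is an expression $a(0)+b(0)/(a(1)+b(1)/(a(2)+b(2)/(a(3)+\cdots)))$ where the $a(n),b(n)$ are rational numbers, $b(n)\neq0$ for all $n$, and $a(n)\neq 0$ for all but finitely many $n$. Its $n$-th convergent $p(n)/q(n)$ is the value of the finite truncation $a(0)+b(0)/(a(1)+\cdots+b(n-1)/a(n))$. It is of polynomial type if there are polynomials $A,B$ (with rational coefficients) such that $a(n)=A(n)$ and $b(n)=B(n)$ for all sufficiently large $n$. It is convergent if its convergents converge to a real limit. $\mathcal{C}\subset\mathbb{R}$ denotes the set of real numbers that are limits of convergent generalized continued fractions of polynomial type. *)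

(* Defs.v *)
From HB Require Import structures.
From mathcomp Require Import all_boot all_order all_algebra.
From mathcomp Require Import all_classical all_reals all_analysis.

Set Implicit Arguments.
Unset Strict Implicit.
Unset Printing Implicit Defensive.

Import Order.TTheory GRing.Theory Num.Theory.
Import numFieldNormedType.Exports.

Local Open Scope classical_set_scope.
Local Open Scope ring_scope.

Record gcf := Gcf {
  cfa : nat -> rat;
  cfb : nat -> rat;
  cfb_neq0 : forall n, cfb n != 0;
  cfa_neq0 : exists N, forall n, (N <= n)%N -> cfa n != 0
}.

(* [truncation a b n] is a(0) + b(0)/(a(1) + ... + b(n-1)/a(n)), evaluated in
   the projective line over Q: [None] is the point at infinity, with the rules
   b/0 = oo (b != 0), b/oo = 0 and a + oo = oo. Since finitely many a(n) may
   vanish, intermediate denominators may vanish too; working with [option rat]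
   keeps the convention x / 0 = 0 of [rat] out of the value. *)
Fixpoint truncation (a b : nat -> rat) (n : nat) : option rat :=
  if n isn't m.+1 then Some (a 0%N) else
  match truncation (fun k => a k.+1) (fun k => b k.+1) m with
  | None => Some (a 0%N)
  | Some x => if x == 0 then None else Some (a 0%N + b 0%N / x)
  end.

Definition convergent (cf : gcf) (n : nat) : option rat :=
  truncation (cfa cf) (cfb cf) n.

(* The value 0 given to an infinite convergent is a junk value; [cf_cvg_to]
   requires all but finitely many convergents to be finite. *)
Definition real_convergent (R : realType) (cf : gcf) (n : nat) : R :=
  ratr (odflt 0 (convergent cf n)).

Definition polynomial_type (cf : gcf) : Prop :=
  exists (A B : {poly rat}) (N : nat), forall n, (N <= n)%N ->
    cfa cf n = A.[n%:R] /\ cfb cf n = B.[n%:R].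

Definition cf_cvg_to (R : realType) (cf : gcf) (u : R) : Prop :=
  (\forall n \near \oo, convergent cf n != None) /\
  (real_convergent R cf n @[n --> \oo] --> u).

Definition polynomial_cf_limits (R : realType) : set R :=
  [set u | exists cf : gcf, polynomial_type cf /\ cf_cvg_to cf u].
Arguments polynomial_cf_limits : clear implicits.

Definition is_minimal_polynomial (R : realType) (u : R) (p : {poly rat}) : Prop :=
  [/\ p \is monic, irreducible_poly p & root (map_poly ratr p) u].

Definition algebraic_of_degree (R : realType) (d : nat) (u : R) : Prop :=
  exists p : {poly rat}, is_minimal_polynomial u p /\ size p = d.+1.

(* Main.v *)
(** The root near 1 of the trinomial equation v = 1 + z v^3 has the expansion
    v = sum_n c_n z^n with c_n = binomial(3n, n) / (2n + 1).  The ratio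
    c_(n+1) / c_n is a rational function of n, so Euler's transformation turns
    the partial sums into the convergents of a continued fraction of polynomial
    type, and c_n ~ g (27/4)^n n^(-3/2) gives an error ~ C / (E^n n^(3/2)) with
    E = 4 / (27 z).
    A cubic irrational u is a Moebius image of every irrational w in Q(u), and a
    Moebius map only changes the first terms of the fraction and the constant C.
    Among the elements w of trace zero, w = x^2 + t x + 2P/3 for the depressed
    cubic x^3 + P x + Q = 0, some are arbitrarily small while their conjugates
    are not.  If w^3 + p w + q = 0, then v = - p w / q satisfies v = 1 + z v^3
    with z = - q^2 / p^3, which is then as small as desired. *)
Require Import Defs.
From HB Require Import structures.
From mathcomp Require Import all_boot all_order all_algebra.
From mathcomp Require Import all_classical all_reals all_analysis.
From mathcomp Require Import zify ring lra.

Set Implicit Arguments.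
Unset Strict Implicit.
Unset Printing Implicit Defensive.

Import Order.TTheory GRing.Theory Num.Theory.
Import numFieldNormedType.Exports.

Local Open Scope classical_set_scope.
Local Open Scope ring_scope.

(** * Fuss-Catalan numbers *)

(* The coefficient of [z^n] in [v^r], from [v^(r+1) = v^r + z v^(r+3)]. *)
Fixpoint fuss_catalan (n r : nat) : nat :=
  if n is m.+1 then (\sum_(k < r) fuss_catalan m k.+3)%N else 1%N.

Lemma fuss_catalanS0 n : fuss_catalan n.+1 0 = 0%N.
Proof. by rewrite /= big_ord0. Qed.

Lemma fuss_catalanSS n r :
  fuss_catalan n.+1 r.+1 = (fuss_catalan n.+1 r + fuss_catalan n r.+3)%N.
Proof. by rewrite /= big_ord_recr. Qed.

(** With s = r + 1, this is the closed form s / (3n + s) * binomial(3n + s, n), cleared of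
    denominators. Induction on n and then on r follows the two-variable recurrence. *)
Lemma fuss_catalan_fact n r :
  (fuss_catalan n r.+1 * (n`! * (r.+1 + 2 * n)`!) = r.+1 * (r + 3 * n)`!)%N.
Proof.
elim: n r => [|n IHn] r.
  by rewrite muln0 !addn0 /= !mul1n factS.
elim: r => [|r IHr].
  rewrite fuss_catalanSS fuss_catalanS0 add0n.
  have := IHn 2%N.
  have -> : (1 + 2 * n.+1 = 3 + 2 * n)%N by lia.
  have -> : (0 + 3 * n.+1 = (2 + 3 * n).+1)%N by lia.
  rewrite !factS; nia.
rewrite fuss_catalanSS; have := IHn r.+3; move: IHr.
have -> : (r.+2 + 2 * n.+1 = (r.+1 + 2 * n.+1).+1)%N by lia.
have -> : (r.+4 + 2 * n = (r.+1 + 2 * n.+1).+1)%N by lia.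
have -> : (r.+3 + 3 * n = r + 3 * n.+1)%N by lia.
have -> : (r.+1 + 3 * n.+1 = (r + 3 * n.+1).+1)%N by lia.
rewrite (factS n) (factS (r + _)) (factS (r.+1 + _)).
set X := (r + 3 * n.+1)`!; set Y := (r.+1 + 2 * n.+1)`!; set Z := n`!.
set a := fuss_catalan n.+1 r.+1; set b := fuss_catalan n r.+4.
move: X Y Z a b => X Y Z a b h1 h2; rewrite mulnDl.
have -> : (a * (n.+1 * Z * ((r.+1 + 2 * n.+1).+1 * Y)) =
  (r.+1 + 2 * n.+1).+1 * (a * (n.+1 * Z * Y)))%N by ring.
have -> : (b * (n.+1 * Z * ((r.+1 + 2 * n.+1).+1 * Y)) =
  n.+1 * (b * (Z * ((r.+1 + 2 * n.+1).+1 * Y))))%N by ring.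
rewrite h1 h2; ring.
Qed.

Lemma fuss_catalan_gt0 n r : (0 < fuss_catalan n r.+1)%N.
Proof. by elim: n r => [|n IHn] r //; rewrite fuss_catalanSS ltn_addl. Qed.

Lemma fuss_catalan_ratio n :
  (fuss_catalan n.+1 1 * ((2 * n + 2) * (2 * n + 3)) =
   fuss_catalan n 1 * (3 * (3 * n + 1) * (3 * n + 2)))%N.
Proof.
have := fuss_catalan_fact n.+1 0; have := fuss_catalan_fact n 0.
have -> : (1 + 2 * n.+1 = (1 + 2 * n).+2)%N by lia.
have -> : (0 + 3 * n.+1 = (0 + 3 * n).+3)%N by lia.
rewrite (factS n) (factS (_ + _).+1) (factS (_ + _)) (factS (_ + 3 * n).+2).
rewrite (factS (_ + 3 * n).+1) (factS (_ + 3 * n)).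
have := fact_gt0 n; have := fact_gt0 (1 + 2 * n).
set X := (0 + 3 * n)`!; set Y := (1 + 2 * n)`!; set Z := n`!.
set a := fuss_catalan n.+1 1; set b := fuss_catalan n 1.
move: X Y Z a b => X Y Z a b; rewrite !mul1n => Y0 Z0 <- h.
apply/eqP; rewrite -(eqn_pmul2l Y0) -(eqn_pmul2l Z0) -(eqn_pmul2l (ltn0Sn n)).
apply/eqP.
transitivity (a * (n.+1 * Z * ((1 + 2 * n).+2 * ((1 + 2 * n).+1 * Y))))%N.
  ring.
rewrite h; ring.
Qed.

(** * Partial sums of the series for the powers of v *)

Section PartialSums.
Variables (R : realFieldType) (z : R).

Lemma fuss_catalan_ratio_ring n :
  (fuss_catalan n.+1 1)%:R * ((2 * n%:R + 2) * (2 * n%:R + 3)) =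
  (fuss_catalan n 1)%:R * (3 * (3 * n%:R + 1) * (3 * n%:R + 2)) :> R.
Proof.
have /eqP := fuss_catalan_ratio n.
by rewrite -(eqr_nat R) !natrM !(natrD _ (_ * n)) !natrM => /eqP.
Qed.

Definition fc_sum (r N : nat) : R :=
  \sum_(k < N) (fuss_catalan k r)%:R * z ^+ k.

(** Truncation of v^(r+1) = v^r + z v^(r+3); the factor z costs the last sum one term. *)
Lemma fc_sumSS r N : fc_sum r.+1 N.+1 = fc_sum r N.+1 + z * fc_sum r.+3 N.
Proof.
rewrite /fc_sum !big_ord_recl -addrA mulr_sumr -big_split.
congr (_ + _); apply: eq_bigr => i _.
by rewrite lift0 fuss_catalanSS natrD mulrDl exprS; congr (_ + _); ring.
Qed.

Lemma fc_sumS r n :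
  fc_sum r n.+1 = fc_sum r n + (fuss_catalan n r)%:R * z ^+ n.
Proof. by rewrite /fc_sum big_ord_recr. Qed.

Lemma fc_sum0S N : fc_sum 0 N.+1 = 1.
Proof.
rewrite /fc_sum big_ord_recl mul1r big1 ?addr0// => i _.
by rewrite lift0 fuss_catalanS0 mul0r.
Qed.

(* [27/4 = (3/2)^3 / (3/2 - 1)] is the constant for which the geometric bound
   survives summation over [r]. *)
Lemma fc_sum_error v r N : v = 1 + z * v ^+ 3 -> `|v| <= 3 / 2 ->
  `|v ^+ r - fc_sum r N| <= (27 / 4 * `|z|) ^+ N * (3 / 2) ^+ r.
Proof.
move=> hv v_le; elim: N r => [|N IHN] r.
  rewrite /fc_sum big_ord0 subr0 expr0 mul1r normrX lerXn2r ?nnegrE//; lra.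
elim: r => [|r IHr].
  rewrite fc_sum0S expr0 subrr normr0 expr0 mulr1; apply: exprn_ge0.
  by apply: mulr_ge0 => //; lra.
have -> : v ^+ r.+1 - fc_sum r.+1 N.+1 =
  (v ^+ r - fc_sum r N.+1) + z * (v ^+ r.+3 - fc_sum r.+3 N).
  by rewrite fc_sumSS exprSr {2}hv !exprS; ring.
apply: (le_trans (ler_normD _ _)); rewrite normrM.
apply: (le_trans (lerD IHr (ler_wpM2l (normr_ge0 z) (IHN r.+3)))).
(* The two bounds add up exactly, since |z| (3/2)^3 is half of 27/4 |z|. *)
rewrite !exprS le_eqVlt; apply/orP; left; apply/eqP.
move: (_ ^+ N) (_ ^+ r) => X Y; by field.
Qed.
End PartialSums.

(** * Asymptotics of the tails *)

Section Asymptotics.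
Variable R : realType.
Implicit Types (x t : nat -> R) (z v : R).

(** As x tends to 0, [x N] is the sum of the later differences, which a geometric series of ratio k
    dominates. *)
Lemma norm_le_geometric x t (k C : R) (N : nat) :
  0 <= k -> k < 1 -> 0 <= C ->
  (forall n, (N <= n)%N -> `|x n - x n.+1| <= C * `|t n|) ->
  (forall n, `|t n.+1| <= k * `|t n|) ->
  x n @[n --> \oo] --> 0 ->
  `|x N| <= C * `|t N| / (1 - k).
Proof.
move=> k0 k1 C0 xd td x0.
have xle j n : (N <= n)%N -> `|x n| <= `|x (n + j)%N| + C * `|t n| / (1 - k).
  elim: j n => [|j IHj] n Nn.
    by rewrite addn0 lerDl divr_ge0 ?mulr_ge0// subr_ge0 ltW.
  have := IHj n.+1 (leqW Nn); have := xd _ Nn; have := td n; rewrite addSnnS.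
  move: `|t n| `|t n.+1| => a b h2 h3 h1.
  have h4 : `|x n| <= `|x n - x n.+1| + `|x n.+1|.
    by apply: le_trans (ler_normD _ _); rewrite subrK.
  have h5 : C * b / (1 - k) <= C * (k * a) / (1 - k).
    by rewrite ler_pM2r ?invr_gt0 ?subr_gt0// ler_wpM2l.
  have h6 : C * a / (1 - k) = C * a + C * (k * a) / (1 - k).
    by field; rewrite subr_eq0 gt_eqF.
  rewrite h6; lra.
apply/ler_addgt0Pl => e e0.
have [j _ xj] : \forall n \near \oo, `|x n| < e by exact: cvgr0_norm_lt.
have := xle j N (leqnn _); have := xj (N + j)%N (leq_addl _ _) => /=.
lra.
Qed.

Lemma natr_powR32 (n : nat) : n%:R `^ (3 / 2) = Num.sqrt (n%:R ^+ 3) :> R.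
Proof. by rewrite powRrM powR_mulrn// powR12_sqrt// exprn_ge0. Qed.

(** This form shows the growth rate 27/4 and the exponent of n, namely (1/3 + 2/3) - (1 + 3/2) =
    -3/2. *)
Lemma fuss_catalan_ratioR (n : nat) :
  (fuss_catalan n.+1 1)%:R = (fuss_catalan n 1)%:R * (27 / 4) *
    ((n%:R + 1 / 3) * (n%:R + 2 / 3) / ((n%:R + 1) * (n%:R + 3 / 2))) :> R.
Proof.
have h := fuss_catalan_ratio_ring R n.
have n0 : 0 <= n%:R :> R by [].
have h2 : (2 * n%:R + 2) * (2 * n%:R + 3) != 0 :> R.
  by rewrite mulf_neq0// lt0r_neq0//; lra.
rewrite -[LHS](mulfK h2) h.
by field; rewrite ?h2 !lt0r_neq0//; lra.
Qed.

(* The square of the sequence is a rational multiple at each step; it increases,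
   while its product with [(n + 4) / n] decreases. *)
Lemma fuss_catalan_cvg : exists2 g : R, 0 < g &
  (fuss_catalan n 1)%:R * (4 / 27) ^+ n * n%:R `^ (3 / 2) @[n --> \oo] --> g.
Proof.
pose d n : R := (fuss_catalan n 1)%:R * (4 / 27) ^+ n.
have d_gt0 n : 0 < d n.
  by rewrite mulr_gt0 ?ltr0n ?fuss_catalan_gt0// exprn_gt0//; lra.
have dS n : d n.+1 = d n * ((n%:R + 1 / 3) * (n%:R + 2 / 3) /
    ((n%:R + 1) * (n%:R + 3 / 2))).
  rewrite /d fuss_catalan_ratioR exprS.
  have n0 : 0 <= n%:R :> R by [].
  by field; rewrite !lt0r_neq0//; lra.
pose h n : R := d n.+1 ^+ 2 * n.+1%:R ^+ 3.
have h_gt0 n : 0 < h n by rewrite mulr_gt0// exprn_gt0.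
have h_nd : nondecreasing_seq h.
  apply/nondecreasing_seqP => n; rewrite -subr_ge0 /h (dS n.+1) -(natr1 n.+1).
  have : 1 <= n.+1%:R :> R by rewrite ler1n.
  move: (n.+1%:R) (d n.+1) => m a m1.
  rewrite [leRHS](_ : _ = a ^+ 2 * (43 / 36 * m ^+ 3 + 17 / 9 * m ^+ 2 +
    40 / 81 * m + 4 / 81) / (m + 3 / 2) ^+ 2); last first.
    by field; rewrite !lt0r_neq0//; lra.
  have m3 : 0 <= m ^+ 3 by apply: exprn_ge0; lra.
  apply: divr_ge0; last exact: sqr_ge0.
  apply: mulr_ge0; first exact: sqr_ge0.
  by have := sqr_ge0 m; lra.
(* With m = n + 1, to leading order one step multiplies [h] by 1 + (43/36) / m^2 and (m + 4) / m by
   1 - 4 / m^2, so the product decreases and bounds [h]. *)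
pose k n : R := h n * ((n.+1%:R + 4) / n.+1%:R).
have k_ni : nonincreasing_seq k.
  apply/nonincreasing_seqP => n; rewrite -subr_ge0 /k /h.
  rewrite (dS n.+1) -(natr1 n.+1).
  have : 1 <= n.+1%:R :> R by rewrite ler1n.
  move: (n.+1%:R) (d n.+1) => m a m1.
  (* Factors m - 1 make each term visibly nonnegative for m >= 1. *)
  rewrite [leRHS](_ : _ = a ^+ 2 * (101 / 36 * (m ^+ 2 * (m - 1)) +
    149 / 36 * (m * (m - 1)) + 605 / 324 * (m - 1) + 175 / 108) /
    (m + 3 / 2) ^+ 2); last first.
    by field; rewrite !lt0r_neq0//; lra.
  have m2 : 0 <= m ^+ 2 * (m - 1) by apply: mulr_ge0; rewrite ?sqr_ge0//; lra.
  have m3 : 0 <= m * (m - 1) by apply: mulr_ge0; lra.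
  apply: divr_ge0; last exact: sqr_ge0.
  apply: mulr_ge0; first exact: sqr_ge0.
  lra.
have hk n : h n <= k 0%N.
  apply: le_trans (k_ni 0%N n (leq0n _)); rewrite /k.
  apply: ler_peMr; first exact: ltW.
  by rewrite ler_pdivlMr// mul1r lerDl.
have hub : has_ubound (range h) by exists (k 0%N) => _ [n _ <-].
have hcv := nondecreasing_is_cvgn h_nd hub.
exists (Num.sqrt (limn h)).
  rewrite sqrtr_gt0; apply: lt_le_trans (h_gt0 0%N) _.
  exact: nondecreasing_cvgn_le.
rewrite -[X in X @ _](_ : (fun n => d n * Num.sqrt (n%:R ^+ 3)) = _);
  last first.
  by apply/funext => n; rewrite natr_powR32.
rewrite -cvg_shiftS /=.
rewrite [X in X @ _](_ : _ = Num.sqrt \o h); last first.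
  apply/funext => n.
  by rewrite /= /h [in RHS]sqrtrM ?sqr_ge0// sqrtr_sqr gtr0_norm.
by apply: continuous_cvg => //; exact: sqrt_continuous.
Qed.

Section Tail.
Variables (z v : R).
Let t n : R := (fuss_catalan n 1)%:R * z ^+ n.

Lemma fc_sum_cvg : v = 1 + z * v ^+ 3 -> `|v| <= 3 / 2 -> `|z| < 4 / 27 ->
  fc_sum z 1 n @[n --> \oo] --> v.
Proof.
move=> vE v_le z_lt.
have k_lt1 : `|27 / 4 * `|z| | < 1 by rewrite ger0_norm ?mulr_ge0//; lra.
apply/cvgrPdist_le => e e0.
have : (27 / 4 * `|z|) ^+ n * (3 / 2) @[n --> \oo] --> 0 * (3 / 2 : R).
  by apply: cvgM; [exact: cvg_expr|exact: cvg_cst].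
rewrite mul0r => /cvgr0_norm_le/(_ _ e0); apply: filterS => n.
apply: le_trans; apply: le_trans (ler_norm _).
by have := fc_sum_error 1 n vE v_le; rewrite !expr1.
Qed.

(** The ratio of consecutive terms tends to 27/4 z, so the tail behaves like a geometric series of
    that ratio. *)
Lemma fc_tail_cvg : v = 1 + z * v ^+ 3 -> `|v| <= 3 / 2 ->
  z != 0 -> `|z| < 4 / 27 ->
  (v - fc_sum z 1 n) / t n @[n --> \oo] --> (1 - 27 / 4 * z)^-1.
Proof.
move=> vE v_le z_neq0 z_lt; have f_cvg := fc_sum_cvg vE v_le z_lt.
pose k := 27 / 4 * `|z|; pose rho := 27 / 4 * z.
have rhoN : `|rho| = k by rewrite /rho /k normrM ger0_norm//; lra.
have k0 : 0 <= k by rewrite mulr_ge0//; lra.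
have k1 : k < 1 by rewrite /k; lra.
have rho1 : 0 < 1 - rho by have := ler_norm z; rewrite /rho; lra.
have t_neq0 n : t n != 0.
  by rewrite mulf_neq0// ?expf_neq0// pnatr_eq0 -lt0n fuss_catalan_gt0.
pose s n : R := (n%:R + 1 / 3) * (n%:R + 2 / 3) / ((n%:R + 1) * (n%:R + 3 / 2)).
have tS n : t n.+1 = rho * s n * t n.
  by rewrite /t fuss_catalan_ratioR exprS /rho /s; ring.
have s_le n : `|s n - 1| <= 2 / n.+1%:R /\ `|s n| <= 1.
  have n0 : 0 <= n%:R :> R by [].
  have s0 : 0 <= s n by rewrite /s divr_ge0// mulr_ge0//; lra.
  have sE : 1 - s n =
      (3 / 2 * n%:R + 23 / 18) / ((n%:R + 1) * (n%:R + 3 / 2)).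
    by rewrite /s; field; rewrite !lt0r_neq0//; lra.
  have s1 : 0 <= 1 - s n by rewrite sE divr_ge0 ?mulr_ge0//; lra.
  split; last by rewrite ger0_norm//; lra.
  rewrite distrC ger0_norm// sE -natr1 ler_pdivrMr;
    last by apply: mulr_gt0; lra.
  rewrite [leRHS](_ : _ = 2 * (n%:R + 3 / 2)); last first.
    by field; rewrite lt0r_neq0//; lra.
  lra.
(* The deviation of the tail from the geometric value; its differences are O(|t n| / n). *)
pose x n := v - fc_sum z 1 n - t n / (1 - rho).
have tfE n : t n = fc_sum z 1 n.+1 - fc_sum z 1 n.
  by rewrite fc_sumS addrC addKr.
have t_cvg0 : t n @[n --> \oo] --> 0.
  rewrite (_ : t = fun n => fc_sum z 1 n.+1 - fc_sum z 1 n); last exact/funext.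
  rewrite -(subrr v); apply: cvgB; last exact: f_cvg.
  by have := f_cvg; rewrite -cvg_shiftS.
have x_cvg0 : x n @[n --> \oo] --> 0.
  rewrite -(subr0 0) -[X in X - _](subrr v) -[X in _ - X](mul0r (1 - rho)^-1).
  apply: cvgB; last by apply: cvgM => //; exact: cvg_cst.
  by apply: cvgB; [exact: cvg_cst|exact: f_cvg].
have xB n : x n - x n.+1 = rho * (s n - 1) / (1 - rho) * t n.
  by rewrite /x fc_sumS -/(t n) tS; field; rewrite lt0r_neq0.
(* The constant in [norm_le_geometric] may depend on the starting index n: 2 / (n + 1) bounds |s m -
   1| for all m >= n. *)
have x_le n : `|x n| <= k * (2 / n.+1%:R) / (1 - rho) * `|t n| / (1 - k).
  apply: norm_le_geometric => // [|m nm|m].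
  - by rewrite divr_ge0 ?(ltW rho1)// mulr_ge0.
  - rewrite xB normrM; apply: ler_wpM2r => //.
    rewrite normrM normfV (gtr0_norm rho1) ler_pM2r ?invr_gt0//.
    rewrite normrM rhoN; apply: ler_wpM2l; first exact: k0.
    apply: (le_trans (s_le m).1); rewrite ler_pM2l// lef_pV2 ?posrE//.
    by rewrite ler_nat.
  - rewrite tS 2!normrM rhoN.
    by apply: ler_wpM2r => //; apply: ler_piMr; [exact: k0|exact: (s_le m).2].
rewrite (_ : (fun _ => _) = fun n => x n / t n + (1 - rho)^-1); last first.
  apply/funext => n; rewrite /x; field; rewrite t_neq0 lt0r_neq0//.
rewrite -[X in _ --> X]add0r; apply: cvgD; last exact: cvg_cst.
have : k * 2 / (1 - rho) / (1 - k) * n.+1%:R^-1 @[n --> \oo] --> (0 : R).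
  rewrite -[X in _ --> X](mulr0 (k * 2 / (1 - rho) / (1 - k))).
  by apply: cvgM; [exact: cvg_cst|exact: cvg_harmonic].
move=> h; apply/cvgr0Pnorm_le => e e0.
move/cvgr0_norm_le : h => /(_ _ e0); apply: filterS => n.
apply: le_trans; apply: le_trans (ler_norm _).
rewrite normrM normfV ler_pdivrMr ?normr_gt0//.
apply: (le_trans (x_le n)).
by rewrite le_eqVlt; apply/orP; left; apply/eqP; ring.
Qed.

(** Product of two limits: the tail against its first term, and that term against E^(-n)
    n^(-3/2). *)
Lemma fc_tail_powR : v = 1 + z * v ^+ 3 -> `|v| <= 3 / 2 ->
  z != 0 -> `|z| < 4 / 27 -> exists2 g : R, g != 0 &
  (v - fc_sum z 1 n) * ((4 / (27 * z)) ^+ n * n%:R `^ (3 / 2))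
    @[n --> \oo] --> g.
Proof.
move=> vE v_le z_neq0 z_lt; have [g g0 hg] := fuss_catalan_cvg.
exists ((1 - 27 / 4 * z)^-1 * g).
  rewrite gt_eqF// mulr_gt0// invr_gt0.
  by have := ler_norm z; lra.
rewrite (_ : (fun _ => _) = fun n => (v - fc_sum z 1 n) / t n *
    ((fuss_catalan n 1)%:R * (4 / 27) ^+ n * n%:R `^ (3 / 2))).
  by apply: cvgM; [exact: fc_tail_cvg|exact: hg].
have c_neq0 n : (fuss_catalan n 1)%:R != 0 :> R.
  by rewrite pnatr_eq0 -lt0n fuss_catalan_gt0.
have -> : 4 / (27 * z) = 4 / 27 / z by rewrite invfM mulrA.
apply/funext => n; rewrite (expr_div_n (4 / 27) z n) /t.
by field; rewrite c_neq0 expf_neq0.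
Qed.
End Tail.
End Asymptotics.

(** * Continued fractions *)

(** Homogeneous coordinates for [truncation], in which infinity needs no separate case. *)
Fixpoint cf_numden (a b : nat -> rat) (n : nat) : rat * rat :=
  if n is m.+1 then
    let x := cf_numden (fun k => a k.+1) (fun k => b k.+1) m in
    (a 0%N * x.1 + b 0%N * x.2, x.1)
  else (a 0%N, 1).

(** As no b(k) vanishes, the two coordinates never vanish together, so a zero denominator means
    infinity. *)
Lemma truncationE (a b : nat -> rat) n : (forall k, b k != 0) ->
  let x := cf_numden a b n in
  (x.2 = 0 -> x.1 != 0) /\
  truncation a b n = if x.2 == 0 then None else Some (x.1 / x.2).
Proof.
elim: n a b => [|n IHn] a b b_neq0 /=.
  by split=> //; rewrite divr1.
have [] := IHn (fun k => a k.+1) _ (fun k => b_neq0 k.+1).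
case: (cf_numden _ _ n) => p q /= pq ->; have b0 := b_neq0 0%N.
have [q0|q0] := eqVneq q 0.
  have p0 := pq q0; split=> [p00|]; first by rewrite p00 eqxx in p0.
  by rewrite (negbTE p0) q0 mulr0 addr0 mulfK.
split=> [->|]; first by rewrite mulr0 add0r mulf_neq0.
rewrite mulf_eq0 invr_eq0 (negbTE q0) orbF; case: eqVneq => // p0.
by congr Some; field; rewrite p0 q0.
Qed.

(** [truncation] unfolds from the front, while the classical recurrence appends at the end. The link
    is that a solution depends linearly on its first two values, with coefficients given by the
    fraction that starts one index later. *)
Lemma cf_numden_recurrence (a b x : nat -> rat) n :
  (forall k, x k.+2 = a k.+1 * x k.+1 + b k * x k) ->
  let y := cf_numden (fun k => a k.+1) (fun k => b k.+1) n in
  x n.+2 = y.1 * x 1%N + b 0%N * y.2 * x 0%N.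
Proof.
elim: n a b x => [|n IHn] a b x xS /=; first by rewrite xS mulr1.
have /= -> := IHn (fun k => a k.+1) (fun k => b k.+1) (fun k => x k.+1)
  (fun k => xS k.+1).
by rewrite xS; ring.
Qed.

Lemma truncation_recurrence (a b p q : nat -> rat) n :
  (forall k, b k != 0) ->
  p 0%N = 1 -> q 0%N = 0 -> p 1%N = a 0%N -> q 1%N = 1 ->
  (forall k, p k.+2 = a k.+1 * p k.+1 + b k * p k) ->
  (forall k, q k.+2 = a k.+1 * q k.+1 + b k * q k) ->
  truncation a b n = if q n.+1 == 0 then None else Some (p n.+1 / q n.+1).
Proof.
move=> b0 p0 q0 p1 q1 pS qS; have [_ ->] := truncationE a n b0.
case: n => [|n] /=; first by rewrite p1 q1.
rewrite (cf_numden_recurrence _ pS) (cf_numden_recurrence _ qS) /=.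
by rewrite p0 q0 p1 q1 mulr0 !mulr1 addr0 (mulrC _ (a 0%N)).
Qed.

(** * Euler's fraction for Moebius images of the partial sums *)

Section EulerFraction.
Variables z al be ga de : rat.

(** The terms t(n) = c_n z^n satisfy Q(n) t(n+1) = P(n) t(n). *)
Let Q (n : nat) : rat := (2 * n%:R + 2) * (2 * n%:R + 3).
Let P (n : nat) : rat := z * (3 * (3 * n%:R + 1) * (3 * n%:R + 2)).
(* Any rational other than the first partial sum's image would do for [a0]. *)
Let a0 : rat := if ga + de == 0 then 0 else (al + be) / (ga + de) + 1.
Let b0 : rat := al + be - a0 * (ga + de).

(** Convergent 0 is [a0], and convergent n >= 1 is to be the Moebius image of the sum of the first n
    terms. The initial entries are solved from this; [a 2] and [b 1] solve a linear system of
    determinant [b0]. *)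
Let a (n : nat) : rat := match n with
  | 0 => a0 | 1 => ga + de | 2 => 6 + 6 * z * ((al - a0 * ga) / b0)
  | m.+3 => Q m.+1 + P m.+1 end.
Let b (n : nat) : rat := match n with
  | 0 => b0 | 1 => 6 * z * ((be * ga - al * de) / b0)
  | m.+2 => - P m.+1 * Q m end.
(* Common shape of the numerators ([c, d] = [al, be]) and of the denominators
   ([c, d] = [ga, de]), shifted by one: index 0 is the convergent 1/0. The
   product of the [Q j] makes the coefficients of the recurrence polynomial. *)
Let w (c d e0 e1 : rat) (n : nat) : rat := match n with
  | 0 => e0 | 1 => e1
  | m.+2 => \prod_(j < m) Q j * (c * fc_sum z 1 m.+1 + d) end.

Let Q_gt0 n : 0 < Q n.
Proof.
have n0 : 0 <= n%:R :> rat by [].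
by rewrite mulr_gt0//; lra.
Qed.

Let fc_sum1 : fc_sum z 1 1 = 1.
Proof. by rewrite /fc_sum big_ord1 mul1r. Qed.

(** For three consecutive sums the relation between terms reads Q (S'' - S') = P (S' - S). It is
    linear and holds for constants, hence for c S + d. *)
Let wSS c d e0 e1 n : w c d e0 e1 n.+4 =
  a n.+3 * w c d e0 e1 n.+3 + b n.+2 * w c d e0 e1 n.+2.
Proof.
have h : Q n.+1 * ((fuss_catalan n.+2 1)%:R * z ^+ n.+2) =
    P n.+1 * ((fuss_catalan n.+1 1)%:R * z ^+ n.+1).
  rewrite mulrA (mulrC (Q _)) (fuss_catalan_ratio_ring rat n.+1) /P exprS.
  by ring.
rewrite /w /a /b !big_ord_recr (fc_sumS z 1 n.+2) (fc_sumS z 1 n.+1) /=.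
move: (\prod_(i < n) _) (fc_sum z 1 n.+1) (Q n) => G f q.
move: h; set t := _ * z ^+ n.+1; set t' := _ * z ^+ n.+2 => h.
have -> : G * q * Q n.+1 * (c * (f + t + t') + d) =
  G * q * (Q n.+1 * (c * (f + t) + d) + c * (Q n.+1 * t')) by ring.
by rewrite h; ring.
Qed.

Lemma fuss_catalan_cf : z != 0 -> `|z| < 4 / 27 -> al * de - be * ga != 0 ->
  exists2 cf : gcf, polynomial_type cf & forall n,
    convergent cf n.+1 = if ga * fc_sum z 1 n.+1 + de == 0 then None
      else Some ((al * fc_sum z 1 n.+1 + be) / (ga * fc_sum z 1 n.+1 + de)).
Proof.
move=> z0 z_lt D0.
have b0_neq0 : b0 != 0.
  rewrite /b0 /a0; case: (eqVneq (ga + de) 0) => [e|e].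
    rewrite mul0r subr0; apply: contra D0 => /eqP h.
    have -> : de = - ga by lra.
    have -> : be = - al by lra.
    by apply/eqP; ring.
  by rewrite mulrDl divfK// mul1r opprD addNKr oppr_eq0.
have n_ge0 n : 0 <= n%:R :> rat by [].
have b_neq0 n : b n != 0.
  case: n => [|[|n]]; rewrite /b; first exact: b0_neq0.
    apply: mulf_neq0; first exact: mulf_neq0.
    by rewrite mulf_neq0 ?invr_eq0// -opprB oppr_eq0.
  apply: mulf_neq0; last by rewrite gt_eqF.
  by rewrite oppr_eq0; apply: mulf_neq0.
(* As |z| < 4/27, |P n| <= 4 (n + 1/3) (n + 2/3) < Q n. *)
have a_neq0 : exists N, forall n, (N <= n)%N -> a n != 0.
  exists 3%N => k /subnKC <-; move: (k - 3)%N => n.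
  rewrite add3n /a lt0r_neq0// /Q /P.
  have := n_ge0 n.+1; have := ler_norm z; have := ler_norm (- z).
  rewrite normrN; move: (n.+1%:R) (`|z|) z_lt => m x x_lt h1 h2 m0.
  have : - (4 / 27) <= z by lra.
  have : 0 <= 3 * (3 * m + 1) * (3 * m + 2).
    by apply: mulr_ge0; [apply: mulr_ge0|]; lra.
  nra.
pose cf := Gcf b_neq0 a_neq0; exists cf.
  (* In terms of the index n of the entry, these are Q(n-2) + P(n-2) and - P(n-1) Q(n-2). *)
  exists ((2 *: 'X - 2%:P) * (2 *: 'X - 1%:P) +
    (3 * z) *: ((3 *: 'X - 5%:P) * (3 *: 'X - 4%:P))).
  exists ((- 3 * z) *: ((3 *: 'X - 2%:P) * (3 *: 'X - 1%:P) *
    ((2 *: 'X - 2%:P) * (2 *: 'X - 1%:P)))).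
  exists 3%N => k /subnKC <-; move: (k - 3)%N => n; rewrite add3n.
  have -> : cfa cf n.+3 = Q n.+1 + P n.+1 by [].
  have -> : cfb cf n.+3 = - P n.+2 * Q n.+1 by [].
  rewrite /P /Q !(hornerD, hornerN, hornerM, hornerZ, hornerX, hornerC).
  by rewrite -(natr1 n.+2) -(natr1 n.+1) -(natr1 n); split; ring.
move=> n; rewrite /convergent.
rewrite (@truncation_recurrence a b (w al be 1 a0) (w ga de 0 1))//.
- have : \prod_(j < n) Q j != 0 by rewrite gt_eqF// prodr_gt0.
  rewrite /w; move: (\prod_(j < n) _) (fc_sum _ _ _) => G f G0.
  rewrite mulf_eq0 (negbTE G0); case: eqVneq => //= f0.
  by congr Some; field; rewrite G0 f0.
- case=> [|[|k]]; last exact: wSS.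
  + by rewrite /w /a /b big_ord0 fc_sum1 /b0; ring.
  + rewrite /w /a /b big_ord0 big_ord1 fc_sumS fc_sum1 /Q expr1.
    have -> /= : (fuss_catalan 1 1) = 1%N.
      by rewrite fuss_catalanSS fuss_catalanS0.
    by move: b0_neq0; rewrite /b0; move: (a0) => c h; field.
- case=> [|[|k]]; last exact: wSS.
  + by rewrite /w /a /b big_ord0 fc_sum1; ring.
  + rewrite /w /a /b big_ord0 big_ord1 fc_sumS fc_sum1 /Q expr1.
    have -> /= : (fuss_catalan 1 1) = 1%N.
      by rewrite fuss_catalanSS fuss_catalanS0.
    by move: b0_neq0; rewrite /b0; move: (a0) => c h; field.
Qed.
End EulerFraction.

(** * Limit and error of the fraction *)

Section Equivalence.
Variable R : realType.

Lemma equiv_of_cvg_mul (F e : nat -> R) (C : R) : C != 0 ->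
  (\forall n \near \oo, e n != 0) ->
  F n * e n @[n --> \oo] --> C -> F ~_\oo (fun n => C / e n).
Proof.
move=> C0 e_neq0 h; apply/eqaddoP => eps eps0.
have Ceps : 0 < eps * `|C| by rewrite mulr_gt0// normr_gt0.
move/cvgrPdist_le : h => /(_ _ Ceps) h.
near=> n.
have en : e n != 0 by near: n.
have : `|C - F n * e n| <= eps * `|C| by near: n.
have -> : (F - (fun n => C / e n)) n = - ((C - F n * e n) / e n).
  by rewrite /= !fctE /=; field.
by rewrite normrN !normrM mulrA ler_pM2r// normr_gt0 invr_neq0.
Unshelve. all: by end_near.
Qed.

Lemma ratr_fc_sum (z : rat) r n :
  ratr (fc_sum z r n) = fc_sum (ratr z) r n :> R.
Proof.
rewrite rmorph_sum; apply: eq_bigr => i _.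
by rewrite rmorphM rmorphXn /= ratr_nat.
Qed.

(** The Moebius images of v and of a partial sum f differ by K (v - f) / (D den), where K is the
    determinant and D, den are the two denominators. So the error constant is multiplied by K /
    D^2. *)
Lemma trinomial_moebius_cf (u v : R) (z al be ga de : rat) :
  z != 0 -> `|ratr z : R| < 4 / 27 ->
  v = 1 + ratr z * v ^+ 3 -> `|v| <= 3 / 2 ->
  al * de - be * ga != 0 -> ratr ga * v + ratr de != 0 ->
  u = (ratr al * v + ratr be) / (ratr ga * v + ratr de) ->
  exists (cf : gcf) (C : R), [/\ polynomial_type cf, cf_cvg_to cf u, C != 0 &
    (fun n : nat => u - real_convergent R cf n) ~_\oo
    (fun n : nat => C / ((4 / (27 * ratr z)) ^+ n * n%:R `^ (3%:R / 2%:R)))].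
Proof.
move=> z0 zR_lt vE v_le det0 D0 uE.
have zR0 : ratr z != 0 :> R by rewrite fmorph_eq0.
have z_lt : `|z| < 4 / 27.
  by rewrite -(ltr_rat R) ratr_norm fmorph_div /= !ratr_nat.
have [cf cfP cfE] := fuss_catalan_cf z0 z_lt det0.
pose f n := fc_sum (ratr z : R) 1 n.
have f_cvg : f n @[n --> \oo] --> v by exact: fc_sum_cvg.
pose den n := ratr ga * f n + ratr de.
pose D := ratr ga * v + ratr de.
have den_cvg : den n @[n --> \oo] --> D.
  by apply: cvgD; [apply: cvgM => //|]; exact: cvg_cst.
have den_neq0 : \forall n \near \oo, den n != 0.
  by apply: cvgr_neq0 den_cvg _.
have cf_near : \forall n \near \oo, convergent cf n != None /\
    real_convergent R cf n = (ratr al * f n + ratr be) / den n.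
  near=> n.
  have denn : den n != 0 by near: n.
  have n0 : (0 < n)%N by near: n; exact: nbhs_infty_gt.
  rewrite /real_convergent -(prednK n0) cfE (prednK n0).
  have denE : den n = ratr (ga * fc_sum z 1 n + de).
    by rewrite rmorphD rmorphM /= ratr_fc_sum.
  have : ga * fc_sum z 1 n + de != 0.
    by apply: contra denn => /eqP h; rewrite denE h rmorph0.
  move=> /negbTE -> /=; split => //.
  by rewrite fmorph_div /= -denE rmorphD rmorphM /= ratr_fc_sum.
have [g g0 hg] := fc_tail_powR vE v_le zR0 zR_lt.
pose K : R := ratr (al * de - be * ga).
have K0 : K != 0 by rewrite fmorph_eq0.
have C0 : K / (D * D) * g != 0.
  apply: mulf_neq0 => //; apply: mulf_neq0 => //.
  by rewrite invr_neq0// mulf_neq0.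
exists cf, (K / (D * D) * g); split => //.
- split; first by apply: filterS cf_near => n [].
  have : (ratr al * f n + ratr be) / den n @[n --> \oo] --> u.
    rewrite uE; apply: cvgM; last exact: cvgV.
    by apply: cvgD; [apply: cvgM => //|]; exact: cvg_cst.
  apply: cvg_trans; apply: near_eq_cvg.
  by apply: filterS cf_near => n [_ ->].
- apply: equiv_of_cvg_mul.
  + exact: C0.
  + near=> n; have n0 : (0 < n)%N by near: n; exact: nbhs_infty_gt.
    rewrite mulf_neq0 ?expf_neq0//;
      first by rewrite mulf_neq0// invr_neq0// mulf_neq0.
    by rewrite gt_eqF// powR_gt0// ltr0n.
  have : K / (D * den n) * ((v - f n) * ((4 / (27 * ratr z)) ^+ n *
      n%:R `^ (3 / 2))) @[n --> \oo] --> K / (D * D) * g.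
    apply: cvgM => //; apply: cvgM; first exact: cvg_cst.
    apply: cvgV; first by rewrite mulf_neq0.
    by apply: cvgM => //; exact: cvg_cst.
  apply: cvg_trans; apply: near_eq_cvg.
  near=> n.
  have denn : den n != 0 by near: n.
  have [_ ->] : convergent cf n != None /\
    real_convergent R cf n = (ratr al * f n + ratr be) / den n by near: n.
  rewrite mulrA; congr (_ * _); rewrite uE -/D.
  rewrite /K rmorphB !rmorphM /= -/(ratr de) -/(ratr al).
  move: denn D0; rewrite -/D /den /D => denn D0'.
  by field; rewrite denn D0'.
Unshelve. all: by end_near.
Qed.
End Equivalence.

(** * Cubic numbers *)

Section CubicNumbers.
Variable R : realType.
Implicit Types (x u : R) (P Q : rat).

Let ratrD (a b : rat) : ratr (a + b) = ratr a + ratr b :> R.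
Proof. exact: rmorphD. Qed.
Let ratrN (a : rat) : ratr (- a) = - ratr a :> R.
Proof. exact: rmorphN. Qed.
Let ratrM (a b : rat) : ratr (a * b) = ratr a * ratr b :> R.
Proof. exact: rmorphM. Qed.
Let ratrX (a : rat) n : ratr (a ^+ n) = ratr a ^+ n :> R.
Proof. exact: rmorphXn. Qed.
Let ratrV (a : rat) : ratr a^-1 = (ratr a)^-1 :> R.
Proof. exact: fmorphV. Qed.
(* [ratr_nat] comes first, so that numerals are not split by [ratrD]. *)
Let ratrE := (ratr_nat R, ratrD, ratrN, ratrM, ratrX, ratrV).

(** Linear independence of 1, x, x^2 over the rationals, the form in which irreducibility of the
    cubic enters the computations. *)
Definition rat_free2 x := forall a b c : rat,
  ratr a * x ^+ 2 + ratr b * x + ratr c = 0 -> [/\ a = 0, b = 0 & c = 0].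

Lemma rat_free2_shift x (s : rat) : rat_free2 x -> rat_free2 (x + ratr s).
Proof.
move=> xf a b c h.
have [] := xf a (2 * a * s + b) (a * s ^+ 2 + b * s + c).
  by rewrite -h !ratrE; ring.
by move=> -> ; rewrite mulr0 !mul0r !add0r => ->; rewrite mul0r add0r.
Qed.

(** A nonzero polynomial of degree at most 2 is coprime to the irreducible cubic, hence shares no
    root with it. *)
Lemma cubic_rat_free2 u : algebraic_of_degree 3 u -> rat_free2 u.
Proof.
move=> [p [[_ [_ p_irr] pu] sp]] a b c h.
pose g : {poly rat} := a *: 'X^2 + b *: 'X + c%:P.
have gE : (map_poly ratr g).[u] = 0.
  rewrite -h /g !(rmorphD, rmorphM) /= !map_polyZ /=.
  rewrite map_polyXn map_polyX map_polyC.
  by rewrite !hornerE.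
have sg : (size g <= 3)%N.
  apply: leq_trans (size_polyD _ _) _; rewrite geq_max; apply/andP; split.
    apply: leq_trans (size_polyD _ _) _; rewrite geq_max; apply/andP; split.
      by apply: leq_trans (size_scale_leq _ _) _; rewrite size_polyXn.
    by apply: leq_trans (size_scale_leq _ _) _; rewrite size_polyX.
  by apply: leq_trans (size_polyC_leq1 _) _.
have g0 : g = 0.
  apply/eqP/negP => /negP g_neq0.
  have pg : coprimep p g.
    apply/negPn/negP => /(p_irr _)/(_ (dvdp_gcdl p g)) /andP[_ pgcd].
    have := dvdp_leq g_neq0 (dvdp_trans pgcd (dvdp_gcdr p g)).
    by rewrite sp leqNgt ltnS sg.
  have := pg; rewrite -(coprimep_map (@ratr R)) => /coprimep_root/(_ pu).
  by rewrite gE eqxx.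
have coefg i : g`_i = a * (i == 2)%:R + b * (i == 1)%:R + c * (i == 0)%:R.
  rewrite /g !coefD !coefZ coefXn coefX coefC.
  by case: (i == 0); rewrite ?mulr1 ?mulr0.
split.
- by have := coefg 2; rewrite g0 coef0 /= mulr1 !mulr0 !addr0.
- by have := coefg 1%N; rewrite g0 coef0 /= mulr1 !mulr0 add0r addr0.
- by have := coefg 0; rewrite g0 coef0 /= mulr1 !mulr0 !add0r.
Qed.

Lemma cubic_depressed u : algebraic_of_degree 3 u ->
  exists s P Q : rat, (u + ratr s) ^+ 3 + ratr P * (u + ratr s) + ratr Q = 0.
Proof.
move=> [p [[pm _ /rootP pu] sp]].
move: pu; rewrite horner_coef size_map_poly sp !big_ord_recl big_ord0.
rewrite !coef_map /=.
have -> : p`_(bump 0 (bump 0 (bump 0 0))) = 1.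
  by move/monicP: pm; rewrite lead_coefE sp.
rewrite rmorph1 mul1r addr0 expr0 mulr1.
set c0 := p`_0; set c1 := p`_ _; set c2 := p`_ _ => pu.
(* Translation by a third of the quadratic coefficient removes the quadratic term. *)
exists (c2 / 3), (c1 - c2 ^+ 2 / 3), (2 * c2 ^+ 3 / 27 - c1 * c2 / 3 + c0).
rewrite -[RHS]pu !ratrE.
by field.
Qed.

(** Otherwise x would be rational: the double root -3Q/(2P) or the simple root 3Q/P, or 0 if P = Q =
    0. *)
Lemma cubic_discriminant_neq0 x P Q : rat_free2 x ->
  x ^+ 3 + ratr P * x + ratr Q = 0 -> 4 * P ^+ 3 + 27 * Q ^+ 2 != 0.
Proof.
move=> xf xE; apply/eqP => disc0.
have discR : 4 * ratr P ^+ 3 + 27 * ratr Q ^+ 2 = 0 :> R.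
  by have := congr1 (@ratr R) disc0; rewrite !ratrE rmorph0.
have : (2 * ratr P * x + 3 * ratr Q) ^+ 2 * (ratr P * x - 3 * ratr Q) = 0.
  transitivity (4 * ratr P ^+ 3 * (x ^+ 3 + ratr P * x + ratr Q)
    - (ratr P * x + ratr Q) * (4 * ratr P ^+ 3 + 27 * ratr Q ^+ 2)).
    by ring.
  by rewrite xE discR !mulr0 subr0.
have PQ0 : P = 0 -> Q = 0 -> False.
  move=> P0 Q0; move: xE; rewrite P0 Q0 rmorph0 mul0r !addr0 => /eqP.
  rewrite expf_eq0 /= => /eqP x0.
  have [] := xf 0 1 0; first by rewrite x0 !rmorph0; ring.
  by move=> _ /eqP; rewrite oner_eq0.
move/eqP; rewrite mulf_eq0 expf_eq0 /= => /orP[] /eqP h.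
- have [] := xf 0 (2 * P) (3 * Q).
    by rewrite rmorph0 mul0r add0r !ratrE.
  by move=> _ P0 Q0; apply: PQ0; lra.
- have [] := xf 0 P (- (3 * Q)).
    by rewrite rmorph0 mul0r add0r !ratrE.
  by move=> _ P0 Q0; apply: PQ0; lra.
Qed.

(* For [t] near the real number [t0] with [w = x^2 + t0 x + 2P/3 = 0], the
   trace-zero number [w] is small while its conjugates are not; [p] and [q] are
   the coefficients of its depressed cubic [w^3 + p w + q = 0]. *)
Lemma small_trace_zero_element x P Q (eps : R) : rat_free2 x ->
  x ^+ 3 + ratr P * x + ratr Q = 0 -> 0 < eps ->
  exists t p q : rat, let w := x ^+ 2 + ratr t * x + ratr (2 * P / 3) in
    [/\ w ^+ 3 + ratr p * w + ratr q = 0, 3 * w ^+ 2 < `|ratr p| &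
        ratr q ^+ 2 < eps * `|ratr p| ^+ 3].
Proof.
move=> xf xE eps0.
(* The constant 2P/3 cancels the trace -2P of x^2; [p] and [q] are the other coefficients of the
   characteristic polynomial of w. *)
pose w t := x ^+ 2 + t * x + 2 * ratr P / 3.
pose p t : R := - ratr P ^+ 2 / 3 + 3 * ratr Q * t + ratr P * t ^+ 2.
pose q t : R := - (2 * ratr P ^+ 3 / 27 + 2 * ratr P ^+ 2 * t ^+ 2 / 3
  - ratr Q * t ^+ 3 + ratr P * ratr Q * t + ratr Q ^+ 2).
have QE : ratr Q = - (x ^+ 3 + ratr P * x).
  by apply/eqP; rewrite -addr_eq0 addrC xE.
have wE t : w t ^+ 3 + p t * w t + q t = 0.
  by rewrite /w /p /q QE; field.
have x0 : x != 0.
  apply/eqP => x0; have [] := xf 0 1 0; first by rewrite x0 !rmorph0; ring.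
  by move=> _ /eqP; rewrite oner_eq0.
pose t0 : R := - (x ^+ 2 + 2 * ratr P / 3) / x.
have w0 : w t0 = 0 by rewrite /w /t0; field.
have q0 : q t0 = 0 by have := wE t0; rewrite w0 expr0n /= mulr0 !add0r.
(* At [t0] one root is 0 and [p t0] is the product of the other two; up to sign it is the
   discriminant over (3x)^2. *)
have p0 : p t0 != 0.
  have -> : p t0 = (4 * ratr P ^+ 3 + 27 * ratr Q ^+ 2) / (9 * x ^+ 2).
    by rewrite /p /t0 QE; field.
  rewrite mulf_neq0 ?invr_neq0 ?mulf_neq0 ?expf_neq0//.
  have := cubic_discriminant_neq0 xf xE; rewrite -(fmorph_eq0 (@ratr R)) /=.
  by rewrite !ratrE.
have poly_cvg (f : {poly R}) (h : R -> R) : (forall t, f.[t] = h t) ->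
    h t @[t --> t0] --> h t0.
  move=> fh; rewrite -fh (_ : h = horner f); last exact/funext.
  exact: continuous_horner.
have w_cvg : w t @[t --> t0] --> w t0.
  apply: (poly_cvg ((x ^+ 2)%:P + x *: 'X + (2 * ratr P / 3)%:P)) => t.
  by rewrite !(hornerD, hornerC, hornerZ, hornerX) /w (mulrC t).
have p_cvg : p t @[t --> t0] --> p t0.
  apply: (poly_cvg ((- ratr P ^+ 2 / 3)%:P + (3 * ratr Q) *: 'X +
    ratr P *: 'X^2)) => t.
  by rewrite !(hornerD, hornerC, hornerZ, hornerX, hornerXn).
have q_cvg : q t @[t --> t0] --> q t0.
  apply: (poly_cvg (- ((2 * ratr P ^+ 3 / 27)%:P +
    (2 * ratr P ^+ 2 / 3) *: 'X^2 - ratr Q *: 'X^3 +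
    (ratr P * ratr Q) *: 'X + (ratr Q ^+ 2)%:P))) => t.
  rewrite !(hornerD, hornerN, hornerC, hornerZ, hornerX, hornerXn) /q; ring.
(* Both inequalities are strict at [t0], where w and q vanish, so by continuity they hold at a
   rational t nearby. *)
have w_near : \forall t \near t0, 0 < `|p t| - 3 * w t ^+ 2.
  have h : `|p t| - 3 * w t ^+ 2 @[t --> t0] --> `|p t0| - 3 * w t0 ^+ 2.
    apply: cvgB; first exact: cvg_norm.
    by apply: cvgM; [exact: cvg_cst|exact: cvgM].
  by apply: (cvgr_gt _ h); rewrite w0 expr0n mulr0 subr0 normr_gt0.
have q_near : \forall t \near t0, 0 < eps * `|p t| ^+ 3 - q t ^+ 2.
  have pE t : `|p t| ^+ 3 = `|p t| * `|p t| * `|p t| by ring.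
  have h : eps * (`|p t| * `|p t| * `|p t|) - q t ^+ 2 @[t --> t0]
      --> eps * (`|p t0| * `|p t0| * `|p t0|) - q t0 ^+ 2.
    have pn : `|p t| @[t --> t0] --> `|p t0| by exact: cvg_norm.
    apply: cvgB; last exact: cvgM.
    by apply: cvgM; [exact: cvg_cst|exact: (cvgM (cvgM pn pn) pn)].
  have l0 : 0 < eps * (`|p t0| * `|p t0| * `|p t0|) - q t0 ^+ 2.
    by rewrite -pE q0 expr0n subr0 mulr_gt0// exprn_gt0// normr_gt0.
  by apply: filterS (cvgr_gt _ h _ l0) => t; rewrite pE.
have [e /= e0 He] : exists2 e : R, 0 < e & forall t, `|t0 - t| < e ->
    0 < `|p t| - 3 * w t ^+ 2 /\ 0 < eps * `|p t| ^+ 3 - q t ^+ 2.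
  have : \forall t \near t0,
    0 < `|p t| - 3 * w t ^+ 2 /\ 0 < eps * `|p t| ^+ 3 - q t ^+ 2.
    by near=> t; split; near: t.
  by move=> /nbhs_ballP[e /= e0 He]; exists e.
have [r] : exists r, ratr r \in `]t0, (t0 + e)[ by apply: rat_in_itvoo; lra.
rewrite in_itv /= => /andP[r1 r2].
have [] := He (ratr r).
  by rewrite ltr_distlC; lra.
rewrite !subr_gt0 => h1 h2.
exists r, (- P ^+ 2 / 3 + 3 * Q * r + P * r ^+ 2),
  (- (2 * P ^+ 3 / 27 + 2 * P ^+ 2 * r ^+ 2 / 3 - Q * r ^+ 3 + P * Q * r
    + Q ^+ 2)).
by rewrite !ratrE; split; [exact: wE|exact: h1|exact: h2].
Unshelve. all: by end_near.
Qed.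

Lemma cubic_trinomial x P Q (eps : R) : rat_free2 x ->
  x ^+ 3 + ratr P * x + ratr Q = 0 -> 0 < eps ->
  exists (z al be ga de : rat) (v : R),
    [/\ z != 0 /\ `|ratr z| < eps, v = 1 + ratr z * v ^+ 3 /\ `|v| <= 3 / 2,
       al * de - be * ga != 0, ratr ga * v + ratr de != 0 &
       x = (ratr al * v + ratr be) / (ratr ga * v + ratr de)].
Proof.
move=> xf xE eps0.
have [t [p [q]]] := small_trace_zero_element xf xE eps0.
set w : R := x ^+ 2 + ratr t * x + ratr (2 * P / 3) => -[wE w_lt q_lt].
have p0 : p != 0.
  apply/eqP => p0; move: w_lt; rewrite p0 rmorph0 normr0.
  by rewrite ltNge pmulr_rge0// sqr_ge0.
have pR0 : ratr p != 0 :> R by rewrite fmorph_eq0.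
have w0 : w != 0.
  apply/eqP => wz; have [] := xf 1 t (2 * P / 3).
    by rewrite rmorph1 mul1r.
  by move=> /eqP; rewrite oner_eq0.
have qE : ratr q = - (w ^+ 3 + ratr p * w).
  by apply/eqP; rewrite -addr_eq0 addrC wE.
(* Since v = p / (w^2 + p), this bound amounts to |v| <= 3/2. *)
have wp : 2 / 3 * `|ratr p| <= `|w ^+ 2 + ratr p|.
  have := ler_normB (w ^+ 2 + ratr p) (w ^+ 2).
  by rewrite addrAC subrr add0r (ger0_norm (sqr_ge0 w)); lra.
have wp0 : w ^+ 2 + ratr p != 0.
  rewrite -normr_gt0; apply: lt_le_trans wp.
  by rewrite mulr_gt0 ?normr_gt0//; lra.
have qE' : ratr q = - w * (w ^+ 2 + ratr p) by rewrite qE; ring.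
have qR0 : ratr q != 0 :> R by rewrite qE' mulf_neq0 ?oppr_eq0.
have q0 : q != 0 by move: qR0; rewrite fmorph_eq0.
pose la := - q / p.
have laE : ratr la = - ratr q / ratr p :> R by rewrite !ratrE.
have la0 : la != 0 by rewrite !mulf_neq0 ?oppr_eq0 ?invr_eq0.
(* The Moebius coefficients come from x (w + P/3 + t^2) = t w - Q - 2Pt/3, a form of the cubic
   equation, with w = la v. *)
exists (- q ^+ 2 / p ^+ 3), (la * t), (- Q - 2 * P * t / 3), la.
exists (P / 3 + t ^+ 2), (w / ratr la).
have lavE : ratr la * (w / ratr la) = w.
  by rewrite mulrC divfK// fmorph_eq0.
have D0 : ratr la * (w / ratr la) + ratr (P / 3 + t ^+ 2) != 0.
  rewrite lavE; apply/eqP => h.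
  have [] := xf 1 t (P + t ^+ 2); last by move=> /eqP; rewrite oner_eq0.
  by rewrite rmorph1 mul1r -h /w !ratrE; field.
split.
- split; first by rewrite !mulf_neq0 ?oppr_eq0 ?invr_eq0 ?expf_neq0.
  rewrite !ratrE normrM normrN normfV !normrX.
  rewrite ltr_pdivrMr ?exprn_gt0 ?normr_gt0//.
  by rewrite real_normK ?num_real.
- split.
    have pwE : ratr p * w = - (w ^+ 3 + ratr q).
      by apply/eqP; rewrite -addr_eq0 -wE; apply/eqP; ring.
    transitivity (- (ratr p * w) / ratr q).
      by rewrite laE; field; rewrite pR0 qR0.
    by rewrite pwE laE !ratrE; field; rewrite pR0 qR0.
  have -> : w / ratr la = ratr p / (w ^+ 2 + ratr p).
    by rewrite laE qE'; field; rewrite pR0 w0 wp0.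
  rewrite normrM normfV ler_pdivrMr ?normr_gt0//; lra.
(* If the determinant vanished, the rational t would be a root of the cubic, which would split off
   the factor x - t. *)
- have -> : la * t * (P / 3 + t ^+ 2) - (- Q - 2 * P * t / 3) * la =
     la * (t ^+ 3 + P * t + Q) by field.
  rewrite mulf_neq0//; apply/eqP => tE.
  have : (x - ratr t) * (x ^+ 2 + ratr t * x + ratr (t ^+ 2 + P)) = 0.
    transitivity (x ^+ 3 + ratr P * x + ratr Q - ratr (t ^+ 3 + P * t + Q) : R).
      by rewrite !ratrE; ring.
    by rewrite xE tE rmorph0 subr0.
  move/eqP; rewrite mulf_eq0 => /orP[] /eqP h.
    have [] := xf 0 1 (- t); first by rewrite -h !ratrE rmorph0 rmorph1; ring.
    by move=> _ /eqP; rewrite oner_eq0.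
  have [] := xf 1 t (t ^+ 2 + P); first by rewrite rmorph1 mul1r.
  by move=> /eqP; rewrite oner_eq0.
- exact: D0.
- apply: (mulIf D0); rewrite divfK// lavE ratrM mulrAC lavE.
  apply/eqP; rewrite -subr_eq0; apply/eqP.
  by rewrite -[RHS]xE /w !ratrE; field.
Qed.
End CubicNumbers.

Theorem theorem3p1 (R : realType) (u : R) (hu : algebraic_of_degree 3 u) :
  polynomial_cf_limits R u /\
  (forall M : R, 0 < M ->
    exists (E : R) (cf : gcf) (C : R),
      [/\ M < `|E|, polynomial_type cf, cf_cvg_to cf u, C != 0 &
        (fun n : nat => u - real_convergent R cf n) ~_\oo
        (fun n : nat => C / (E ^+ n * n%:R `^ (3%:R / 2%:R)))]).
Proof.
suff main (M : R) : 0 < M -> exists (E : R) (cf : gcf) (C : R),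
    [/\ M < `|E|, polynomial_type cf, cf_cvg_to cf u, C != 0 &
      (fun n : nat => u - real_convergent R cf n) ~_\oo
      (fun n : nat => C / (E ^+ n * n%:R `^ (3%:R / 2%:R)))].
  split; last exact: main.
  by have [_ [cf [_ [_ cf_poly cf_cvg _ _]]]] := main 1 ltr01; exists cf.
move=> M0; have [s [P [Q xE]]] := cubic_depressed hu.
have xf : rat_free2 (u + ratr s).
  exact/rat_free2_shift/cubic_rat_free2.
(* The bound 4/27 makes the series converge, and 4/(27M) gives |E| > M for E = 4/(27z). *)
pose eps : R := Num.min (4 / 27) (4 / (27 * M)).
have eps0 : 0 < eps by rewrite lt_min !divr_gt0// mulr_gt0.
have [z [al [be [ga [de [v]]]]]] := cubic_trinomial xf xE eps0.
rewrite lt_min => -[[z0 /andP[z_lt z_ltM]] [vE v_le] det0 D0 uE].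
(* Translating back from u + s to u keeps the determinant. *)
have det0' : (al - s * ga) * de - (be - s * de) * ga != 0.
  by apply: contra det0 => /eqP h; apply/eqP; rewrite -[RHS]h; ring.
have uE' : u = (ratr (al - s * ga) * v + ratr (be - s * de)) /
    (ratr ga * v + ratr de).
  rewrite !(rmorphB, rmorphM) /= -[LHS](addrK (ratr s)) uE.
  by field.
have [cf [C [cf_poly cf_cvg C0 cf_equiv]]] :=
  trinomial_moebius_cf z0 z_lt vE v_le det0' D0 uE'.
exists (4 / (27 * ratr z)), cf, C; split=> //.
have zR0 : 0 < `|ratr z : R| by rewrite normr_gt0 fmorph_eq0.
have -> : `|4 / (27 * ratr z) : R| = 4 / (27 * `|ratr z|).
  by rewrite normrM normfV normrM !normr_nat.
rewrite ltr_pdivlMr ?mulr_gt0//.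
move: z_ltM; rewrite ltr_pdivlMr ?mulr_gt0//.
by congr (_ < _); ring.
Qed.
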